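(* Let $(X,\mathcal{B},\mu,T)$ be an ergodic measure-preserving dynamical system on a non-atomic probability space ($\mu(X)=1$). For each $1<p<\infty$ there exists a finite constant $C_p$ such that for all measurable functions $f\ge 0$ with $f\in L^p(\mu)$, all measurable $g\ge 0$ with $g\in L^1(\mu)$, and all $\lambda>0$, $$\mu\Big\{x\in X:\ \sup_{n\ge 1}\frac{f(T^nx)\,g(T^{2n}x)}{n}>\lambda\Big\}\le C_p\left(\frac{\|f\|_p\,\|g\|_1}{\lambda}\right)^{1/2}.$$ Moreover, there exists a finite constant $\widetilde C$ such that $C_p\le \dfrac{\widetilde C}{p-1}$ for all $1<p<2$.
   Context: $T:X\to X$ is an invertible-or-not measurable map preserving $\mu$ and ergodic; $\|\cdot\|_p$ denotes the $L^p(\mu)$ norm. The constants $C_p$ and $\widetilde C$ do not depend on $f$, $g$ or $\lambda$. *)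

(* Defs.v *)
From HB Require Import structures.
From mathcomp Require Import all_boot all_order all_algebra.
From mathcomp Require Import all_classical all_reals all_analysis.
Set Implicit Arguments. Unset Strict Implicit. Unset Printing Implicit Defensive.
Import Order.TTheory GRing.Theory Num.Theory.
Local Open Scope classical_set_scope.
Local Open Scope ring_scope.

Definition measure_preserving d (X : measurableType d) (R : realType)
  (mu : {measure set X -> \bar R}) (T : X -> X) : Prop :=
  measurable_fun setT T /\
  forall A : set X, measurable A -> mu (T @^-1` A) = mu A.

Definition ergodic d (X : measurableType d) (R : realType)
  (mu : {measure set X -> \bar R}) (T : X -> X) : Prop :=
  forall A : set X, measurable A -> T @^-1` A = A ->
    mu A = 0%E \/ mu A = 1%E.

Definition nonatomic d (X : measurableType d) (R : realType)
  (mu : {measure set X -> \bar R}) : Prop :=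
  forall A : set X, measurable A -> (0 < mu A)%E ->
    exists2 B : set X, measurable B /\ B `<=` A & (0 < mu B < mu A)%E.

Definition ergodic_bilinear_max d (X : measurableType d) (R : realType)
  (T : X -> X) (f g : X -> R) (x : X) : \bar R :=
  ereal_sup [set ((f (iter n T x) * g (iter (2 * n) T x)) / n%:R)%:E
            | n in [set n : nat | (0 < n)%N]].

(* Main.v *)
(** For [D <= n < 2 * D] the points [T^n x] and [T^(2n) x] lie in a window of
    length [4 * D]. Discard the set where some average of [f ^ p] along the orbit
    exceeds [K ^ p]; by the maximal ergodic theorem its measure is at most
    [(||f||_p / K) ^ p]. For the remaining [x], shift by [T^(4D - 2n)] so that the
    argument of [g] becomes the fixed point [y = T^(4D) x]: since the average of
    [f ^ p] before [y] is at most [K ^ p], Markov's inequality bounds the number of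
    [n] in the block with [f (T^n x) g (T^(2n) x) > lam n] by
    [4 * D * min 1 ((s / D) ^ p)], where [s = g y * K / lam]. Summing over dyadic [D]
    gives a multiple of [s * p / (p - 1)], hence a total measure
    [O ((||f||_p / K) ^ p + p / (p - 1) * K ||g||_1 / lam)]. Take
    [K ^ 2 = lam ||f||_p / ||g||_1]; since the bound is trivial when
    [||f||_p ||g||_1 >= lam], the power [p] of the first term only helps. *)
Require Import Defs.
From HB Require Import structures.
From mathcomp Require Import all_boot all_order all_algebra.
From mathcomp Require Import all_classical all_reals all_analysis.
From mathcomp Require Import measurable_realfun ring lra zify.
Import Order.TTheory GRing.Theory Num.Theory.
Local Open Scope classical_set_scope.
Local Open Scope ring_scope.

(** * Geometric series and sums over dyadic scales *)

(* The sum of [2 ^ (j * (1 - p))] over [j >= 0]. *)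
Definition geo_const {R : realType} (p : R) : R := (1 - 2 `^ (1 - p))^-1.

Lemma powR2_lt1 {R : realType} (p : R) : 1 < p -> 2 `^ (1 - p) < 1.
Proof.
move=> p1; rewrite /powR pnatr_eq0 /= expR_lt1 pmulr_llt0 ?subr_lt0 //.
by rewrite ln_gt0 // ltr1n.
Qed.

Lemma geo_const_ge1 {R : realType} (p : R) : 1 < p -> 1 <= geo_const p.
Proof.
move=> p1; have h := powR2_lt1 p p1.
have h0 := powR_gt0 (1 - p) (ltr0n R 2).
by rewrite /geo_const invf_ge1; lra.
Qed.

Lemma geo_const_eq {R : realType} (p : R) : 1 < p ->
  geo_const p = 1 + geo_const p * 2 `^ (1 - p).
Proof.
move=> p1; have h := powR2_lt1 p p1.
rewrite /geo_const; field; lra.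
Qed.

(** Since [1 + u <= expR u], [2 ^ (p - 1) - 1] is at least [ln 2 * (p - 1)]: this is the source of
    the [1 / (p - 1)] growth. *)
Lemma geo_const_le {R : realType} (p : R) : 1 < p ->
  geo_const p <= 1 + (ln 2 * (p - 1))^-1.
Proof.
move=> p1; have ln2 : 0 < ln 2 :> R by rewrite ln_gt0 // ltr1n.
have hq : 0 < ln 2 * (p - 1) :> R by rewrite mulr_gt0 //; lra.
have hE : 1 + ln 2 * (p - 1) <= 2 `^ (p - 1) :> R.
  by rewrite /powR pnatr_eq0 /= mulrC expR_ge1Dx.
have -> : geo_const p = 1 + (2 `^ (p - 1) - 1)^-1.
  rewrite /geo_const -(opprB p 1) powRN; field.
  by apply/andP; split; lra.
by rewrite lerD2l lef_pV2 ?posrE //; lra.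
Qed.

(* Scales [2 ^ j <= s] contribute at most [2 * s]; the larger ones form a geometric
   series of ratio [2 ^ (1 - p)]. *)
Lemma dyadic_sum_le {R : realType} (p s : R) (J : nat) : 1 < p -> 0 <= s ->
  \sum_(0 <= j < J) 2 ^+ j * Num.min 1 ((s / 2 ^+ j) `^ p)
    <= (geo_const p + 2) * s.
Proof.
move=> p1.
pose F J s : R := \sum_(0 <= j < J) 2 ^+ j * Num.min 1 ((s / 2 ^+ j) `^ p).
have F0 x : F 0%N x = 0 by rewrite /F big_nil.
(* Peeling off [j = 0] turns the remaining scales into the same sum at [x / 2], so the inductions
   below must cover all [x]. *)
have FS n x : F n.+1 x = Num.min 1 (x `^ p) + 2 * F n (x / 2).
  rewrite /F big_nat_recl // expr0 mul1r divr1 mulr_sumr; congr (_ + _).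
  by apply: eq_bigr => i _; rewrite exprS mulrA invfM mulrA.
have k1 := geo_const_ge1 p p1; have kE := geo_const_eq p p1.
have small n : forall x, 0 <= x -> F n x <= geo_const p * x `^ p.
  elim: n => [|n IH] x x0; first by rewrite F0 mulr_ge0 ?powR_ge0 //; lra.
  have kx : geo_const p * x `^ p = x `^ p + geo_const p * 2 `^ (1 - p) * x `^ p.
    by rewrite {1}kE; ring.
  have minx : Num.min 1 (x `^ p) <= x `^ p by rewrite ge_min lexx orbT.
  rewrite FS.
  have := IH (x / 2) ltac:(lra); rewrite powRM //.
  have -> : 2^-1 `^ p = 2^-1 * 2 `^ (1 - p) :> R.
    rewrite powRD ?pnatr_eq0 ?implybT // powRr1 // mulKf ?pnatr_eq0 //.
    by rewrite -[2^-1]powR_inv1 // -powRrM mulN1r.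
  lra.
have sp x : 0 <= x -> x <= 1 -> x `^ p <= x.
  move=> x0 x1.
  have [->|xn0] := eqVneq x 0; first by rewrite powR0 //; lra.
  by rewrite ge1r_powR ?x1 ?andbT ?lt_def ?xn0 // ltW.
(* The extra [- 1] closes the induction: doubled, it absorbs the peeled term, which is at most 1.
   For [1 <= x < 2] the slack [2 * x >= 2] pays for it, with [small] bounding the rest. *)
have large n : forall x, 0 <= x -> F n x <= (geo_const p + 2) * x
    /\ (1 <= x -> F n x <= (geo_const p + 2) * x - 1).
  elim: n => [|n IH] x x0.
    rewrite F0; split; first by rewrite mulr_ge0 //; lra.
    by move=> x1; have := ler_wpM2l (ltac:(lra) : 0 <= geo_const p + 2) x1; lra.
  have := small n.+1 x x0.
  have [x1 h|x1 _] := ltP x 1.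
    split=> [|x1']; last lra.
    have := ler_wpM2l (ltac:(lra) : 0 <= geo_const p) (sp x x0 (ltW x1)); lra.
  suff hh : F n.+1 x <= (geo_const p + 2) * x - 1 by split => //; lra.
  have m1 : Num.min 1 (x `^ p) <= 1 by rewrite ge_min lexx.
  have [x2|x2] := leP 1 (x / 2).
    have [_ /(_ x2)] := IH (x/2) ltac:(lra); rewrite FS; lra.
  have hs := small n (x/2) ltac:(lra).
  have := ler_wpM2l (ltac:(lra) : 0 <= geo_const p) (sp (x/2) ltac:(lra) (ltW x2)).
  rewrite FS; lra.
by move=> s0; have [] := large J s s0.
Qed.

(** * Counting in one dyadic block *)

(* Markov's inequality for [F ^ p] on the block, using the window average at one [n] of the block. *)
Lemma block_count_le {R : realType} (p K lam G : R) (F : nat -> R)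
    (c : nat -> bool) (D : nat) :
  1 < p -> 0 < K -> 0 < lam -> 0 <= G -> (0 < D)%N -> (forall n, 0 <= F n) ->
  (forall n, c n -> lam * n%:R < F n * G /\
     \sum_(1 <= k < (2 * n).+1) F k `^ p <= (2 * n)%:R * K `^ p) ->
  \sum_(D <= n < 2 * D) (c n)%:R
    <= 4 * (D%:R * Num.min 1 ((G * K / lam / D%:R) `^ p)).
Proof.
move=> p1 K0 lam0 G0 D0 F0 cP.
have D0R : 0 < D%:R :> R by rewrite ltr0n.
have rhs0 : 0 <= 4 * (D%:R * Num.min 1 ((G * K / lam / D%:R) `^ p)).
  by rewrite mulr_ge0 // mulr_ge0 // le_min ler01 powR_ge0.
have [[n0 [n0D cn0]]|none] :=
    pselect (exists n, (D <= n < 2 * D)%N /\ c n); last first.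
  rewrite big_nat big1 // => n nD.
  by case cn: (c n) => //; case: none; exists n.
have card_le : \sum_(D <= n < 2 * D) (c n)%:R <= D%:R :> R.
  apply: (@le_trans _ _ (\sum_(D <= n < 2 * D) 1)).
    by apply: ler_sum => n _; case: (c n).
  by rewrite big_const_nat iter_addr_0 -[X in (X - _)%N]/(2 * D)%N mul2n -addnn addnK.
have Gpos : 0 < G.
  rewrite lt_neqAle G0 andbT; apply/negP => /eqP GE.
  have [] := cP n0 cn0; rewrite -GE mulr0 => h _.
  have : 0 <= lam * n0%:R by rewrite mulr_ge0 // ltW.
  lra.
(* Markov threshold: [c n] with [D <= n] forces [F n] above [lam * D / G]. *)
have tpos : 0 < lam * D%:R / G by rewrite divr_gt0 // mulr_gt0.
have step : (\sum_(D <= n < 2 * D) (c n)%:R) * (lam * D%:R / G) `^ p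
    <= 4 * D%:R * K `^ p.
  rewrite mulr_suml.
  apply: (@le_trans _ _ (\sum_(D <= n < 2 * D) F n `^ p)).
    rewrite big_nat [leRHS]big_nat; apply: ler_sum => n /andP[Dn _].
    case cn: (c n); last by rewrite mul0r powR_ge0.
    rewrite mul1r ge0_ler_powR ?nnegrE //; [lra|exact: ltW|].
    rewrite ler_pdivrMr //; have [h _] := cP n cn.
    apply: le_trans (ltW h); rewrite ler_wpM2l ?(ltW lam0) // ler_nat //.
  (* The window [[1, 2 * n0]] contains the whole block because [D <= n0], and [2 * n0 <= 4 * D]
     yields the factor 4. *)
  have [_ avg] := cP n0 cn0; case/andP: n0D => Dn0 n0D.
  apply: (@le_trans _ _ (\sum_(1 <= k < (2 * n0).+1) F k `^ p)); last first.
    apply: (le_trans avg); rewrite ler_wpM2r ?powR_ge0 // -natrM ler_nat; lia.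
  rewrite (@big_cat_nat _ _ _ D 1) /=; [|lia|lia].
  rewrite (@big_cat_nat _ _ _ (2 * D) D (2 * n0).+1) /=; [|lia|lia].
  rewrite addrCA lerDl addr_ge0 // sumr_ge0 // => i _; exact: powR_ge0.
have [h|h] := leP 1 ((G * K / lam / D%:R) `^ p); first by lra.
have tp := powR_gt0 p tpos.
rewrite -(ler_pM2r tp); apply: (le_trans step).
have KE : G * K / lam / D%:R * (lam * D%:R / G) = K.
  by field; rewrite !gt_eqF.
rewrite -[K in leLHS]KE powRM ?(ltW tpos) //; last first.
  by rewrite !divr_ge0 ?mulr_ge0 // ltW.
by rewrite !mulrA.
Qed.

(** * Measurability and invariance under [T] *)

Lemma measurable_bool_set {d} {X : measurableType d} (b : X -> bool) :
  measurable_fun setT b -> measurable [set x | b x].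
Proof.
move=> mb; rewrite (_ : [set _ | _] = setT `&` b @^-1` [set true]); first exact: mb.
by rewrite setTI; apply/seteqP; split.
Qed.

Lemma measure_preserving_iter {d} {X : measurableType d} {R : realType}
    (mu : {measure set X -> \bar R}) (T : X -> X) (n : nat) :
  measure_preserving mu T -> measure_preserving mu (iter n T).
Proof.
move=> [mT presT]; elim: n => [|n [mTn presTn]]; first by split=> //=; exact: measurable_id.
have mTS : measurable_fun setT (iter n.+1 T) by exact: measurableT_comp.
split=> // A mA; rewrite (_ : iter n.+1 T @^-1` A = iter n T @^-1` (T @^-1` A)) //.
by rewrite presTn ?presT // -[X in measurable X]setTI; exact: mT.
Qed.

Lemma ge0_integral_measure_preserving {d} {X : measurableType d} {R : realType}
    (mu : {measure set X -> \bar R}) (T : X -> X) (F : X -> \bar R) :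
  measure_preserving mu T -> measurable_fun setT F -> (forall x, 0 <= F x)%E ->
  (\int[mu]_x F (T x) = \int[mu]_x F x)%E.
Proof.
move=> [mT presT] mF F0.
have := @ge0_integral_pushforward _ _ _ _ _ _ mT mu _ _ measurableT mF (fun y _ => F0 y).
rewrite preimage_setT => <-.
pose mT' := isMeasurableFun.Build _ _ _ _ T mT.
pose T' : {mfun X >-> X} := HB.pack T mT'.
apply: (@eq_measure_integral _ _ _ _ mu (pushforward mu T')) => A mA _.
exact: presT.
Qed.

(** * The maximal ergodic theorem *)

(* The positive part of the maximum over [n <= N] of [\sum_(m < n) h (T^m x) - n * K]. *)
Fixpoint hopf_max {X : Type} {R : realType} (T : X -> X) (h : X -> R) (K : R)
    (N : nat) (x : X) : R :=
  if N is N'.+1 then Num.max 0 (h x - K + hopf_max T h K N' (T x)) else 0.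

Lemma hopf_max_ge0 {X : Type} {R : realType} (T : X -> X) (h : X -> R) K N x :
  0 <= hopf_max T h K N x.
Proof. by case: N => //= N; rewrite le_max lexx. Qed.

Lemma hopf_max_nondecreasing {X : Type} {R : realType} (T : X -> X) (h : X -> R) K N x :
  hopf_max T h K N x <= hopf_max T h K N.+1 x.
Proof.
elim: N x => [|N IH] x; first exact: hopf_max_ge0.
by rewrite /= ge_max le_max lexx /= le_max lerD2l IH orbT.
Qed.

Lemma hopf_max_ge_sum {X : Type} {R : realType} (T : X -> X) (h : X -> R) K n x :
  \sum_(0 <= m < n) h (iter m T x) - n%:R * K <= hopf_max T h K n x.
Proof.
elim: n x => [|n IH] x; first by rewrite big_nil mul0r subr0.
rewrite big_nat_recl //= le_max; apply/orP; right.
have -> : \sum_(0 <= m < n) h (T (iter m T x)) = \sum_(0 <= m < n) h (iter m T (T x)).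
  by apply: eq_bigr => m _; rewrite -iterS iterSr.
have := IH (T x); rewrite -natr1; lra.
Qed.

Lemma measurable_hopf_max {d} {X : measurableType d} {R : realType}
    (T : X -> X) (h : X -> R) K N :
  measurable_fun setT T -> measurable_fun setT h ->
  measurable_fun setT (hopf_max T h K N).
Proof.
move=> mT mh; elim: N => [|N IH] //=.
apply: measurable_maxr => //; apply: measurable_funD => //.
  exact: measurable_funB.
exact: measurableT_comp.
Qed.

(* Garsia's argument: integrate [hopf_max N.+1 + K * \1_{hopf_max N.+1 > 0} <= h + hopf_max N \o T];
   invariance of [mu] and monotonicity in [N] cancel the two [hopf_max] terms. *)
Lemma hopf_maximal {d} {X : measurableType d} {R : realType}
    (mu : {measure set X -> \bar R}) (T : X -> X) (h : X -> R) (K : R) (N : nat) :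
  measure_preserving mu T -> measurable_fun setT h -> (forall x, 0 <= h x) ->
  (\int[mu]_x (h x)%:E < +oo)%E -> 0 < K ->
  (K%:E * mu [set x | (0 < hopf_max T h K N x)%R] <= \int[mu]_x (h x)%:E)%E.
Proof.
move=> mpT mh h0 hfin K0; have [mT _] := mpT.
pose W := hopf_max T h K.
have mW n : measurable_fun setT (W n) by exact: measurable_hopf_max.
have mWE n : measurable_fun setT (fun x => (W n x)%:E) by exact/measurable_EFinP.
have mhE : measurable_fun setT (fun x => (h x)%:E) by exact/measurable_EFinP.
have mA n : measurable [set x | 0 < W n x].
  by apply: measurable_bool_set; exact: measurable_fun_ltr.
have W0 n x : (0 <= (W n x)%:E)%E by rewrite lee_fin; exact: hopf_max_ge0.
have hE0 x : (0 <= (h x)%:E)%E by rewrite lee_fin.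
have K1E n x : (0 <= K%:E * (\1_[set x | (0 < W n x)%R] x)%:E)%E.
  by rewrite -EFinM lee_fin mulr_ge0 // ltW.
have mK1 n : measurable_fun setT
    (fun x => K%:E * (\1_[set x | (0 < W n x)%R] x)%:E)%E.
  by apply/measurable_EFinP; apply: measurable_funM => //; exact: measurable_indic.
have step n : (\int[mu]_x (W n.+1 x)%:E + K%:E * mu [set x | (0 < W n.+1 x)%R]
    <= \int[mu]_x (h x)%:E + \int[mu]_x (W n x)%:E)%E.
  rewrite -(ge0_integral_measure_preserving mu T (fun x => (W n x)%:E)) //.
  rewrite -[X in (K%:E * mu X)%E]setIT -integral_indic // -ge0_integralZl_EFin ?(ltW K0) //; last first.
    by apply/measurable_EFinP; exact: measurable_indic.
  have mWT : measurable_fun setT (fun x => (W n (T x))%:E).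
    by apply/measurable_EFinP; exact: measurableT_comp.
  rewrite -!ge0_integralD //.
  apply: ge0_le_integral => //.
  + by move=> x _; exact: adde_ge0.
  + exact: emeasurable_funD.
  + exact: emeasurable_funD.
  move=> x _; rewrite -EFinM -!EFinD lee_fin indicE.
  have [Wx|Wx] := ltP 0 (W n.+1 x).
    rewrite mem_set // mulr1; move: Wx; rewrite /W /= -/(W n).
    rewrite lt_max ltxx /= => Wx; rewrite max_r; [lra|exact: ltW].
  rewrite memNset; last by apply/negP; rewrite -leNgt.
  by rewrite mulr0 addr0 (le_trans Wx) // addr_ge0 // hopf_max_ge0.
(* Cancelling the [hopf_max] integrals in the extended reals requires them to be finite; [step]
   itself propagates this. *)
have Wfin n : (\int[mu]_x (W n x)%:E < +oo)%E.
  elim: n => [|n IH]; first by rewrite /W /= integral0.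
  apply: (@le_lt_trans _ _ (\int[mu]_x (h x)%:E + \int[mu]_x (W n x)%:E)%E).
    apply: le_trans (step n); rewrite leeDl // mule_ge0 //.
    by rewrite lee_fin ltW.
  exact: lte_add_pinfty.
case: N => [|N].
  rewrite [X in mu X](_ : _ = set0) ?measure0 ?mule0 ?integral_ge0 //.
  by apply/seteqP; split => x //=; rewrite ltxx.
have WN : (\int[mu]_x (W N x)%:E \is a fin_num)%E.
  by rewrite ge0_fin_numE ?integral_ge0.
rewrite -(leeD2lE _ _ WN) [leRHS]addeC; apply: le_trans (step N).
rewrite leeD2r //; apply: ge0_le_integral => // x _.
by rewrite lee_fin hopf_max_nondecreasing.
Qed.

(** The bound of [hopf_maximal] is uniform in [N] and the sets increase with [N], so it passes to
    their union by continuity from below. *)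
Lemma maximal_ergodic {d} {X : measurableType d} {R : realType}
    (mu : {measure set X -> \bar R}) (T : X -> X) (h : X -> R) (K : R) :
  measure_preserving mu T -> measurable_fun setT h -> (forall x, 0 <= h x) ->
  (\int[mu]_x (h x)%:E < +oo)%E -> 0 < K ->
  exists B : set X,
    [/\ measurable B,
        (mu B <= K^-1%:E * \int[mu]_x (h x)%:E)%E &
        forall x n, n%:R * K < \sum_(0 <= m < n) h (iter m T x) -> B x].
Proof.
move=> mpT mh h0 hfin K0; have [mT _] := mpT.
pose A n := [set x | 0 < hopf_max T h K n x].
have mA n : measurable (A n).
  apply: measurable_bool_set; apply: measurable_fun_ltr => //.
  exact: measurable_hopf_max.
exists (\bigcup_n A n); split; first exact: bigcupT_measurable.
- have AS : {homo A : n m / (n <= m)%N >-> (n <= m)%O}.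
    move=> n m nm; apply/subsetPset => x; rewrite /A /=.
    move=> /lt_le_trans; apply; rewrite -(subnKC nm).
    elim: (m - n)%N => [|k IH]; first by rewrite addn0.
    by rewrite (le_trans IH) // addnS hopf_max_nondecreasing.
  have cv := nondecreasing_cvg_mu (mu := mu) mA (bigcupT_measurable A mA) AS.
  rewrite -(cvg_lim _ cv) //; apply: lime_le; first by apply/cvg_ex; eexists; exact: cv.
  apply: nearW => n /=; rewrite lee_pdivlMl //.
  exact: hopf_maximal.
- move=> x n xn; exists n => //; rewrite /A /=.
  by have := hopf_max_ge_sum T h K n x; lra.
Qed.

(** * Good pairs and their measure over a block *)

(** The window is the stretch of orbit just before the argument of [g], so the shift turns it into
    the window of [block_count_le]. *)
Definition good_pair {X : Type} {R : realType} (T : X -> X) (f g : X -> R)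
    (p K lam : R) (n : nat) : set X :=
  [set x | (lam * n%:R < f (iter n T x) * g (iter (2 * n) T x)) &&
           (\sum_(0 <= m < 2 * n) f (iter m T x) `^ p <= (2 * n)%:R * K `^ p)].

Lemma measurable_good_pair {d} {X : measurableType d} {R : realType}
    (T : X -> X) (f g : X -> R) (p K lam : R) (n : nat) :
  measurable_fun setT T -> measurable_fun setT f -> measurable_fun setT g ->
  measurable (good_pair T f g p K lam n).
Proof.
move=> mT mf mg.
have mTn m : measurable_fun setT (iter m T).
  elim: m => [|m IH]; first exact: measurable_id.
  exact: measurableT_comp.
apply: measurable_bool_set; apply: measurable_and.
- apply: measurable_fun_ltr => //; apply: measurable_funM.
    exact: (measurableT_comp mf).
  exact: (measurableT_comp mg).
- apply: measurable_fun_ler => //; apply: measurable_sum => m.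
  apply: (measurableT_comp (measurable_powR p)).
  exact: (measurableT_comp mf).
Qed.

Lemma good_pair_block {d} {X : measurableType d} {R : realType}
    (mu : {measure set X -> \bar R}) (T : X -> X) (f g : X -> R)
    (p K lam : R) (D : nat) :
  measure_preserving mu T ->
  measurable_fun setT f -> (forall x, 0 <= f x) ->
  measurable_fun setT g -> (forall x, 0 <= g x) ->
  1 < p -> 0 < K -> 0 < lam -> (0 < D)%N ->
  (\sum_(D <= n < 2 * D) mu (good_pair T f g p K lam n) <=
   \int[mu]_x (4 * (D%:R * Num.min 1 ((g x * K / lam / D%:R) `^ p)))%:E)%E.
Proof.
move=> mpT mf f0 mg g0 p1 K0 lam0 D0; have [mT _] := mpT.
pose P n := good_pair T f g p K lam n.
have mP n : measurable (P n) by exact: measurable_good_pair.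
have mpTn n := measure_preserving_iter mu T n mpT.
have mH : measurable_fun setT
    (fun x => (4 * (D%:R * Num.min 1 ((g x * K / lam / D%:R) `^ p)))%:E).
  apply/measurable_EFinP; do 2 apply: measurable_funM => //.
  apply: measurable_minr => //.
  apply: (measurableT_comp (measurable_powR p)).
  by do 3 apply: measurable_funM => //.
have H0 x : (0 <= (4 * (D%:R * Num.min 1 ((g x * K / lam / D%:R) `^ p)))%:E)%E.
  by rewrite lee_fin mulr_ge0 // mulr_ge0 // le_min ler01 powR_ge0.
rewrite -(ge0_integral_measure_preserving mu _ _ (mpTn (4 * D)%N) mH H0).
have muP n : (mu (P n) = \int[mu]_x (\1_(P n) (iter (4 * D - 2 * n) T x))%:E)%E.
  rewrite (ge0_integral_measure_preserving mu _ (fun x => (\1_(P n) x)%:E)) //.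
  - by rewrite integral_indic // setIT.
  - by apply/measurable_EFinP; exact: measurable_indic.
rewrite (eq_bigr _ (fun n _ => muP n)) -ge0_integral_sum //; last first.
  move=> n; apply/measurable_EFinP.
  apply: (measurableT_comp (measurable_indic (mP n))); exact: (mpTn _).1.
apply: ge0_le_integral => //.
- by move=> x _; apply: sume_ge0 => n _; rewrite lee_fin.
- apply: emeasurable_sum => n; apply/measurable_EFinP.
  apply: (measurableT_comp (measurable_indic (mP n))); exact: (mpTn _).1.
- by apply: (measurableT_comp mH); exact: (mpTn _).1.
move=> y _; rewrite sumEFin lee_fin.
(* The guard [n < 2 * D] keeps the subtraction [4 * D - 2 * n] from truncating, since
   [block_count_le] quantifies over every [n]. *)
pose c n := (n < 2 * D)%N && (iter (4 * D - 2 * n) T y \in P n).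
rewrite (_ : \sum_(D <= n < 2 * D) _ = \sum_(D <= n < 2 * D) (c n)%:R); last first.
  rewrite big_nat [RHS]big_nat; apply: eq_bigr => n /andP[_ nD].
  by rewrite /c nD indicE.
(* The orbit is read backwards from [T ^ (4 * D) y]: the point fed to [f] lies [n] steps before it,
   and the window is the [2 * n] preceding points. *)
apply: (block_count_le p K lam _ (fun k => f (iter (4 * D - k) T y))) => //.
move=> n /andP[nD]; rewrite inE => /andP[].
rewrite -!iterD.
have -> : (n + (4 * D - 2 * n) = 4 * D - n)%N by lia.
have -> : (2 * n + (4 * D - 2 * n) = 4 * D)%N by lia.
move=> H1 H2; split=> //; apply: le_trans H2.
rewrite big_add1 /= big_nat_rev /= add0n big_nat [leRHS]big_nat le_eqVlt; apply/orP; left.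
apply/eqP; apply: eq_bigr => k /andP[_ k2n].
by rewrite -iterD; congr (f (iter _ T y) `^ p); lia.
Qed.

(** * Level sets of the bilinear maximal function *)

Lemma bilinear_max_levelE {d} {X : measurableType d} {R : realType}
    (T : X -> X) (f g : X -> R) (lam : R) :
  [set x | (lam%:E < ergodic_bilinear_max T f g x)%E] =
  \bigcup_n [set x | lam * n.+1%:R < f (iter n.+1 T x) * g (iter (2 * n.+1) T x)].
Proof.
apply/seteqP; split => x /=.
  move=> /ereal_sup_gt [_ [[//|n] _ <-]].
  by rewrite lte_fin ltr_pdivlMr ?ltr0n // => H; exists n.
move=> [n _ /= H]; apply: (@lt_le_trans _ _
  ((f (iter n.+1 T x) * g (iter (2 * n.+1) T x)) / n.+1%:R)%:E).
  by rewrite lte_fin ltr_pdivlMr ?ltr0n.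
by apply: ereal_sup_ubound; exists n.+1.
Qed.

Lemma measurable_bilinear_max_level {d} {X : measurableType d} {R : realType}
    (T : X -> X) (f g : X -> R) (lam : R) :
  measurable_fun setT T -> measurable_fun setT f -> measurable_fun setT g ->
  measurable [set x | (lam%:E < ergodic_bilinear_max T f g x)%E].
Proof.
move=> mT mf mg; rewrite bilinear_max_levelE; apply: bigcupT_measurable => n.
apply: measurable_bool_set; apply: measurable_fun_ltr => //.
have mTn m : measurable_fun setT (iter m T).
  by elim: m => [|m IH]; [exact: measurable_id|exact: measurableT_comp].
by apply: measurable_funM; [exact: (measurableT_comp mf)|exact: (measurableT_comp mg)].
Qed.

(** [K] stays free: raising it shrinks the exceptional set of [maximal_ergodic] but enlarges the
    good-pair bound linearly. *)
Lemma bilinear_max_bound {d} {X : measurableType d} {R : realType}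
    (mu : {measure set X -> \bar R}) (T : X -> X) (f g : X -> R)
    (p K lam : R) :
  measure_preserving mu T ->
  measurable_fun setT f -> (forall x, 0 <= f x) ->
  (\int[mu]_x (f x `^ p)%:E < +oo)%E ->
  measurable_fun setT g -> (forall x, 0 <= g x) ->
  1 < p -> 0 < K -> 0 < lam ->
  (mu [set x | (lam%:E < ergodic_bilinear_max T f g x)%E] <=
   (K `^ p)^-1%:E * \int[mu]_x (f x `^ p)%:E +
   (4 * (geo_const p + 2) * K / lam)%:E * \int[mu]_x (g x)%:E)%E.
Proof.
move=> mpT mf f0 ffin mg g0 p1 K0 lam0; have [mT _] := mpT.
have mfp : measurable_fun setT (fun x => f x `^ p).
  exact: (measurableT_comp (measurable_powR p)).
have [B [mB muB HB]] := maximal_ergodic mu T (fun x => f x `^ p) (K `^ p) mpT mfp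
  (fun x => powR_ge0 _ _) ffin (powR_gt0 _ K0).
pose P n := good_pair T f g p K lam n.
have mP n : measurable (P n) by exact: measurable_good_pair.
have mU : measurable (\bigcup_n P n.+1) by exact: bigcupT_measurable.
apply: (@le_trans _ _ (mu (B `|` \bigcup_n P n.+1))).
  apply: le_measure; rewrite ?inE.
  - exact: measurable_bilinear_max_level.
  - exact: measurableU.
  rewrite bilinear_max_levelE => x [n _ Qx].
  have [av|av] := leP (\sum_(0 <= m < 2 * n.+1) f (iter m T x) `^ p)
                      ((2 * n.+1)%:R * K `^ p).
    by right; exists n => //; apply/andP; split.
  by left; exact: HB av.
apply: (@le_trans _ _ (mu B + mu (\bigcup_n P n.+1))%E); first exact: measureU2.
apply: leeD => //.
apply: (@le_trans _ _ (\sum_(0 <= n <oo) mu (P n.+1))%E).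
  by apply: measure_sigma_subadditive => // n; exact: mP.
apply: lime_le; first by apply: is_cvg_nneseries.
apply: nearW => N /=.
(* [N < 2 ^ N] allows enlarging the range to the full blocks [[2 ^ j, 2 ^ (j + 1))] with [j < N]. *)
apply: (@le_trans _ _ (\sum_(1 <= n < 2 ^ N) mu (P n))%E).
  rewrite -(big_add1 _ _ 0 N.+1 xpredT (fun n => mu (P n))).
  have N2 : (N.+1 <= 2 ^ N)%N by exact: ltn_expl.
  by rewrite [leRHS](@big_cat_nat _ _ _ N.+1) //= leeDl // sume_ge0.
pose H j x : R := 4 * ((2 ^ j)%N%:R * Num.min 1 ((g x * K / lam / (2 ^ j)%N%:R) `^ p)).
have H0 j x : 0 <= H j x.
  by rewrite mulr_ge0 // mulr_ge0 // le_min ler01 powR_ge0.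
have mH j : measurable_fun setT (fun x => (H j x)%:E).
  apply/measurable_EFinP; do 2 apply: measurable_funM => //.
  apply: measurable_minr => //.
  apply: (measurableT_comp (measurable_powR p)).
  by do 3 apply: measurable_funM => //.
apply: (@le_trans _ _ (\sum_(0 <= j < N) \int[mu]_x (H j x)%:E)%E).
  elim: N => [|N IH]; first by rewrite expn0 !big_geq.
  rewrite (@big_cat_nat _ _ _ (2 ^ N)) /=; [|by rewrite expn_gt0|by rewrite leq_exp2l].
  rewrite big_nat_recr //= leeD // expnS.
  by apply: good_pair_block => //; rewrite expn_gt0.
rewrite -ge0_integral_sum //; last by move=> j x _; rewrite lee_fin.
have c0 : 0 <= 4 * (geo_const p + 2) * K / lam.
  have := geo_const_ge1 p p1.
  by move=> k1; rewrite divr_ge0 ?ltW // !mulr_gt0 //; lra.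
rewrite -ge0_integralZl_EFin //; last first.
- exact/measurable_EFinP.
- by move=> x _; rewrite lee_fin.
apply: ge0_le_integral => //.
- by move=> x _; apply: sume_ge0 => j _; rewrite lee_fin.
- exact: emeasurable_sum.
- by apply/measurable_EFinP/measurable_funM.
move=> x _; rewrite sumEFin -EFinM lee_fin.
have s0 : 0 <= g x * K / lam by rewrite divr_ge0 ?mulr_ge0 // ltW.
have := dyadic_sum_le p _ N p1 s0; rewrite /H -mulr_sumr => h.
rewrite (_ : _ * g x = 4 * ((geo_const p + 2) * (g x * K / lam))); last by ring.
by rewrite ler_pM2l //; under eq_bigr do rewrite natrX.
Qed.

(** * Choice of the level [K] *)

(** At this level both [a / K] and [K * b] equal [sqrt (a * b)]. If that is at least 1, [m <= 1]
    suffices; otherwise its power [p] is no larger than itself. *)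
Lemma optimize_level_gt0 {R : realType} (p a b c m : R) :
  1 < p -> 0 <= c -> 0 < a -> 0 < b -> m <= 1 ->
  m <= (a / Num.sqrt (a / b)) `^ p + c * (Num.sqrt (a / b) * b) ->
  m <= (1 + c) * Num.sqrt (a * b).
Proof.
move=> p1 c0 a0 b0 m1.
have [t1 _|t1] := leP 1 (Num.sqrt (a * b)).
  by apply: (le_trans m1); rewrite -[leLHS]mul1r ler_pM // lerDl.
have sa : 0 < Num.sqrt a by rewrite sqrtr_gt0.
have sb : 0 < Num.sqrt b by rewrite sqrtr_gt0.
have t0 : 0 < Num.sqrt (a * b) by rewrite sqrtr_gt0 mulr_gt0.
have aE : a = Num.sqrt a * Num.sqrt a by rewrite -expr2 sqr_sqrtr // ltW.
have bE : b = Num.sqrt b * Num.sqrt b by rewrite -expr2 sqr_sqrtr // ltW.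
have tE : Num.sqrt (a * b) = Num.sqrt a * Num.sqrt b by rewrite sqrtrM // ltW.
have KE : Num.sqrt (a / b) = Num.sqrt a / Num.sqrt b.
  by rewrite sqrtrM ?ltW // sqrtrV // ltW.
have -> : a / Num.sqrt (a / b) = Num.sqrt (a * b).
  by rewrite KE tE {1}aE; field; rewrite !gt_eqF.
have -> : Num.sqrt (a / b) * b = Num.sqrt (a * b).
  by rewrite KE tE {2}bE; field; rewrite gt_eqF.
move=> mle; apply: (le_trans mle); rewrite mulrDl mul1r lerD2r.
by apply: ge1r_powR; [rewrite t0 ltW|exact: ltW].
Qed.

(* The optimal level is [K = sqrt (a / b)]; perturbing [a] and [b] covers the
   cases [a = 0] and [b = 0]. *)
Lemma optimize_level {R : realType} (p a b c m : R) :
  1 < p -> 0 <= c -> 0 <= a -> 0 <= b -> m <= 1 ->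
  (forall K, 0 < K -> m <= (a / K) `^ p + c * (K * b)) ->
  m <= (1 + c) * Num.sqrt (a * b).
Proof.
move=> p1 c0 a0 b0 m1 H.
have He e : 0 < e -> m <= (1 + c) * Num.sqrt ((a + e) * (b + e)).
  move=> e0; apply: (@optimize_level_gt0 _ p) => //; try lra.
  have K0 : 0 < Num.sqrt ((a + e) / (b + e)) by rewrite sqrtr_gt0 divr_gt0; lra.
  apply: (le_trans (H _ K0)); apply: lerD.
    apply: ge0_ler_powR; rewrite ?nnegrE ?divr_ge0 ?(ltW K0) //; try lra.
    by rewrite ler_wpM2r ?invr_ge0 ?(ltW K0) //; lra.
  by rewrite ler_wpM2l // ler_wpM2l ?(ltW K0) //; lra.
rewrite leNgt; apply/negP => mgt.
pose t := m / (1 + c).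
have c1 : 0 < 1 + c by lra.
have tgt : Num.sqrt (a * b) < t by rewrite /t ltr_pdivlMr // mulrC.
have t0 : 0 < t by apply: le_lt_trans tgt; exact: sqrtr_ge0.
have ab0 : 0 <= a * b by exact: mulr_ge0.
have abt : a * b < t ^+ 2.
  by rewrite -(sqr_sqrtr ab0) ltr_pXn2r ?nnegrE ?sqrtr_ge0 // ltW.
(* [del] is half the gap below [t ^+ 2]; as [e <= 1], the product grows by at most
   [e * (a + b + 1) <= del]. *)
pose del := (t ^+ 2 - a * b) / 2; have del0 : 0 < del by rewrite /del; lra.
pose e := Num.min 1 (del / (a + b + 1)).
have ab1 : 0 < a + b + 1 by lra.
have e0 : 0 < e by rewrite /e lt_min ltr01 divr_gt0.
have e1 : e <= 1 by rewrite /e ge_min lexx.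
have ed : e * (a + b + 1) <= del by rewrite -ler_pdivlMr // /e ge_min lexx orbT.
have prod_lt : (a + e) * (b + e) < t ^+ 2.
  have -> : (a + e) * (b + e) = a * b + e * (a + b + e) by ring.
  have : e * (a + b + e) <= e * (a + b + 1) by rewrite ler_pM2l //; lra.
  move: ed del0; rewrite /del; lra.
have : Num.sqrt ((a + e) * (b + e)) < t.
  by rewrite -[t]ger0_norm ?(ltW t0) // -sqrtr_sqr ltr_sqrt // exprn_gt0.
have := He e e0; rewrite -(ler_pdivrMl _ _ c1) mulrC -/t; lra.
Qed.

(** * Passage to norms and conclusion *)

Lemma integral_powR_Lnorm {d} {X : measurableType d} {R : realType}
    (mu : {measure set X -> \bar R}) (f : X -> R) (p : R) :
  0 < p -> (forall x, 0 <= f x) -> (Lnorm mu p%:E (EFin \o f) < +oo)%E ->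
  (\int[mu]_x (f x `^ p)%:E = (fine (Lnorm mu p%:E (EFin \o f)) `^ p)%:E)%E.
Proof.
move=> p0 f0 ffin; rewrite -poweR_EFin fineK; last first.
  by rewrite ge0_fin_numE // Lnorm_ge0.
rewrite poweR_Lnorm ?gt_eqF //; apply: eq_integral => x _ /=.
by rewrite ger0_norm // poweR_EFin.
Qed.

Theorem theorem1 (d : measure_display) (X : measurableType d) (R : realType)
  (mu : probability X R) (T : X -> X) :
  measure_preserving mu T -> ergodic mu T -> nonatomic mu ->
  exists C : R -> R,
    (forall p : R, 1 < p ->
      forall (f g : X -> R) (lam : R),
        measurable_fun setT f -> (forall x, 0 <= f x) ->
        (Lnorm mu p%:E (EFin \o f) < +oo)%E ->
        measurable_fun setT g -> (forall x, 0 <= g x) ->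
        (Lnorm mu 1%:E (EFin \o g) < +oo)%E ->
        0 < lam ->
        (mu [set x | (lam%:E < ergodic_bilinear_max T f g x)%E]
          <= (C p * Num.sqrt (fine (Lnorm mu p%:E (EFin \o f))
                              * fine (Lnorm mu 1%:E (EFin \o g)) / lam))%:E)%E)
    /\ exists Ct : R, forall p : R, 1 < p < 2 -> C p <= Ct / (p - 1).
Proof.
move=> mpT _ _.
(* The 1 pays for the exceptional set, 4 for the block count, [geo_const p + 2] for the dyadic
   sum. *)
exists (fun p => 1 + 4 * (geo_const p + 2)); split; last first.
  have ln2 : 0 < ln 2 :> R by rewrite ln_gt0 // ltr1n.
  (* The constant is [9 + 4 * geo_const p <= 13 + 4 / (ln 2 * (p - 1))], and [p < 2] gives
     [13 <= 13 / (p - 1)]. *)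
  exists (13 + 4 / ln 2) => p /andP[p1 p2].
  have q0 : 0 < p - 1 by lra.
  rewrite mulrDl; have := geo_const_le p p1; rewrite invfM.
  have : 13 <= 13 / (p - 1) by rewrite ler_peMr // invf_ge1 //; lra.
  lra.
move=> p p1 f g lam mf f0 ffin mg g0 gfin lam0.
have p0 : 0 < p by lra.
set a := fine (Lnorm mu p%:E (EFin \o f)).
set b := fine (Lnorm mu 1%:E (EFin \o g)).
have a0 : 0 <= a by rewrite fine_ge0 // Lnorm_ge0.
have b0 : 0 <= b by rewrite fine_ge0 // Lnorm_ge0.
have fE : (\int[mu]_x (f x `^ p)%:E = (a `^ p)%:E)%E by exact: integral_powR_Lnorm.
have gE : (\int[mu]_x (g x)%:E = b%:E)%E.
  have := integral_powR_Lnorm mu g 1 ltr01 g0 gfin; rewrite -/b powRr1 // => <-.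
  by apply: eq_integral => x _; rewrite powRr1.
set E := [set x | _].
have bound K : 0 < K ->
    (mu E <= ((a / K) `^ p + 4 * (geo_const p + 2) * (K * (b / lam)))%:E)%E.
  move=> K0; have ffin' : (\int[mu]_x (f x `^ p)%:E < +oo)%E by rewrite fE ltry.
  have := bilinear_max_bound mu T f g p K lam mpT mf f0 ffin' mg g0 p1 K0 lam0.
  rewrite fE gE -!EFinM -EFinD; congr (_ <= _%:E)%E; congr (_ + _).
    rewrite powRM ?invr_ge0 ?(ltW K0) // mulrC.
    by rewrite -[K^-1]powR_inv1 ?(ltW K0) // -powRrM mulN1r powRN.
  by ring.
have finE : mu E \is a fin_num.
  by rewrite ge0_fin_numE //; apply: le_lt_trans (bound 1 ltr01) (ltry _).
have mu1 : fine (mu E) <= 1.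
  rewrite -lee_fin fineK //; apply: probability_le1.
  by apply: measurable_bilinear_max_level => //; case: mpT.
rewrite -(fineK finE) lee_fin -mulrA.
(* [b / lam] takes the role of [b], and [mu1] supplies the trivial bound by 1. *)
apply: (@optimize_level _ p) => //.
- have := geo_const_ge1 p p1; lra.
- by rewrite divr_ge0 // ltW.
by move=> K /bound; rewrite -{1}(fineK finE) lee_fin.
Qed.
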